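(* Let $A$ be a reduced ring containing $\mathbb{F}_p$ that has an absolute $p$-basis $\mathcal{B}$. Then for each $\beta\in\mathbb{N}^{\oplus\mathcal{B}}$ there exists a differential operator $D_A^{[\mathcal{B};\beta]}:A\to A$ of order $|\beta|$ over $\mathbb{F}_p$ such that $$D_A^{[\mathcal{B};\beta]}(\mathcal{B}^\alpha)=\binom{\alpha}{\beta}\mathcal{B}^{\alpha-\beta}$$ for all $\alpha\in\mathbb{N}^{\oplus\mathcal{B}}$.
   Context: Put $A^p=\{a^p\mid a\in A\}$. A (possibly infinite) subset $\mathcal{B}\subset A$ is an absolute $p$-basis of $A$ if $A$ is a free $A^p$-module with basis the family of $p$-monomials $b_1^{\alpha_1}\cdots b_r^{\alpha_r}$, with $r\in\mathbb{N}$, $b_1,\dots,b_r\in\mathcal{B}$ distinct and $0\le\alpha_i<p$. Differential operators: let $k$ be a ring, $A$ a $k$-algebra, $M$ an $A$-module. A map $\Delta:A\to M$ is a differential operator of order $0$ over $k$ if it is $A$-linear. For $n>0$, $\Delta$ is a differential operator of order $n$ over $k$ if it is $k$-linear and, for every $a\in A$, the map $[a,\Delta]:f\mapsto a\Delta(f)-\Delta(af)$ is a differential operator of order $n-1$ over $k$ (so ''order $n$'' means order at most $n$). Multi-indices: $\mathbb{N}^{\oplus\mathcal{B}}$ is the set of tuples $\beta=(\beta_b)_{b\in\mathcal{B}}$ of natural numbers with almost all entries zero; $|\beta|=\sum_b\beta_b$; $\binom{\alpha}{\beta}=\prod_b\binom{\alpha_b}{\beta_b}$, where $\binom{\alpha_b}{\beta_b}=0$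 if $\alpha_b<\beta_b$; $\mathcal{B}^\alpha=\prod_b b^{\alpha_b}\in A$. The expression $\binom{\alpha}{\beta}\mathcal{B}^{\alpha-\beta}$ is understood to be $0$ unless $\beta_b\le\alpha_b$ for all $b$. *)

(* Defs.v *)
From mathcomp Require Import all_boot all_algebra.
From mathcomp Require Import finmap.
From mathcomp Require Import boolp classical_sets.

Set Implicit Arguments.
Unset Strict Implicit.
Unset Printing Implicit Defensive.

Import GRing.Theory.

Local Open Scope ring_scope.

Definition reduced_ring (A : pzRingType) : Prop :=
  forall (x : A) (n : nat), x ^+ n = 0 -> x = 0.

Section DifferentialOperators.
Variables (k : comNzRingType) (A : comAlgType k) (M : lmodType A).

(* M is a k-module by restriction of scalars along c |-> c%:A. *)
Definition linear_over_base (D : A -> M) : Prop :=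
  forall (c : k) (x y : A), D (c *: x + y) = c%:A *: D x + D y.

Definition commutator (a : A) (D : A -> M) : A -> M :=
  fun f => a *: D f - D (a * f).

Fixpoint diff_op (n : nat) (D : A -> M) : Prop :=
  match n with
  | 0 => linear (D : A^o -> M)
  | m.+1 => linear_over_base D /\ forall a : A, diff_op m (commutator a D)
  end.

End DifferentialOperators.

Arguments diff_op k {A M} n D.

Section MultiIndices.
Variable I : choiceType.

Definition multi_index := {fsfun I -> nat with 0%N}.

Implicit Types alpha beta : multi_index.

Definition mi_deg beta : nat := (\sum_(b <- finsupp beta) beta b)%N.

(* Both supports matter: the product vanishes when some beta b > alpha b = 0. *)
Definition mi_binomial alpha beta : nat :=
  (\prod_(b <- finsupp alpha `|` finsupp beta) 'C(alpha b, beta b))%N%fset.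

(* Truncated subtraction; it only occurs multiplied by mi_binomial alpha beta,
   which is 0 unless beta <= alpha pointwise. *)
Definition mi_sub alpha beta : multi_index :=
  [fsfun b in finsupp alpha => (alpha b - beta b)%N | 0%N].

End MultiIndices.

Definition monomial (A : comNzRingType) (B : set A) (alpha : multi_index B) : A :=
  \prod_(b <- finsupp alpha) val b ^+ alpha b.

(* The family v is a basis of A as a module over the subring S of A. *)
Definition basis_over (A : comNzRingType) (S : set A)
    (I : choiceType) (v : I -> A) : Prop :=
  (forall x : A, exists c : {fsfun I -> A with 0},
     (forall i, S (c i)) /\ x = \sum_(i <- finsupp c) c i * v i) /\
  (forall c : {fsfun I -> A with 0},
     (forall i, S (c i)) -> \sum_(i <- finsupp c) c i * v i = 0 ->
     forall i, c i = 0).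

Definition p_powers (p : nat) (A : comNzRingType) : set A :=
  range (fun a : A => a ^+ p).

Arguments p_powers p A : clear implicits.

Definition p_exponents (p : nat) (I : choiceType) : set (multi_index I) :=
  [set alpha : multi_index I | forall b, (alpha b < p)%N]%classic.

Arguments p_exponents p I : clear implicits.

Definition absolute_p_basis (p : nat) (A : comNzRingType) (B : set A) : Prop :=
  basis_over (p_powers p A)
    (fun alpha : p_exponents p B => monomial (val alpha)).

(* Main.v *)
(* For beta < p^e the operator D_beta is built by induction on e: writing
   beta = p q + r with r < p, Lucas' congruence forces
     D_beta (c^p B^gamma) = (D_q c)^p 'C(gamma, r) B^(gamma - r),
   and since Frobenius is injective (A is reduced) and B is a p-basis this
   defines an additive, A^(p^e)-linear map.  For the order, Pascal's rule
   gives [b, D_beta] = - D_(beta - b) for b in B (and 0 if beta_b = 0).  By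
   induction on |beta| these have order |beta| - 1; the set of a such that
   [a, D_beta] has order |beta| - 1 is a ring containing B and stable under
   multiplication by p^e-th powers, hence is all of A. *)
Require Import Defs.
From mathcomp Require Import all_boot all_algebra.
From mathcomp Require Import finmap.
From mathcomp Require Import boolp classical_sets.
Set Implicit Arguments.
Unset Strict Implicit.
Unset Printing Implicit Defensive.
Import GRing.Theory.
Local Open Scope ring_scope.

(** * Hasse derivatives of powers in one variable: Pascal's rule and Lucas' congruence *)

(* The value at [x] of the [n]-th Hasse derivative of ['X^m]. *)
Definition hasse_term (R : comNzRingType) (x : R) (m n : nat) : R :=
  'C(m, n)%:R * x ^+ (m - n).

Lemma hasse_term0 (R : comNzRingType) (x : R) m : hasse_term x m 0 = x ^+ m.
Proof. by rewrite /hasse_term bin0 mul1r subn0. Qed.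

Lemma hasse_term_small (R : comNzRingType) (x : R) m n :
  (m < n)%N -> hasse_term x m n = 0.
Proof. by move=> lt_mn; rewrite /hasse_term bin_small ?mul0r. Qed.

Lemma hasse_termSS (R : comNzRingType) (x : R) m n :
  hasse_term x m.+1 n.+1 = hasse_term x m n + x * hasse_term x m n.+1.
Proof.
(* The exponents [m - n] and [(m - n.+1).+1] agree only for [n < m]; otherwise truncated subtraction
   breaks this, but the binomial coefficient of the last term vanishes. *)
have [lt_mn|le_nm] := ltnP m n.+1.
  rewrite (hasse_term_small _ lt_mn) mulr0 addr0 /hasse_term binS.
  by rewrite (bin_small lt_mn) add0n subSS.
rewrite /hasse_term binS natrD mulrDl addrC subSS; congr (_ + _).
by rewrite mulrCA -exprS subnSK.
Qed.

(** Multiplication by ['X + x%:P] acts on coefficients by Pascal's rule. Congruences between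
    binomial coefficients thus become polynomial identities, where Frobenius is available. *)
Lemma coef_hasse_term (R : comNzRingType) (x : R) m n :
  (('X + x%:P) ^+ m)`_n = hasse_term x m n.
Proof.
elim: m n => [|m IHm] [|n].
- by rewrite coef1 hasse_term0.
- by rewrite coef1 hasse_term_small.
- by rewrite exprS mulrDl coefD coefXM coefCM IHm add0r !hasse_term0 exprS.
- by rewrite exprS mulrDl coefD coefXM coefCM !IHm hasse_termSS.
Qed.

Lemma exprD_pchar (R : comNzRingType) (p : nat) (x y : R) :
  p \in [pchar R] -> (x + y) ^+ p = x ^+ p + y ^+ p.
Proof.
move=> pR; apply: exprDn_pchar; rewrite pnatE ?(pcharf_prime pR) //.
Qed.

(** Compares coefficients in (X + x)^(p+m) = (X^p + x^p) (X + x)^m. *)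
Lemma hasse_term_addp (R : comNzRingType) (p : nat) (x : R) m n :
  p \in [pchar R] ->
  hasse_term x (p + m) n =
    x ^+ p * hasse_term x m n + (if (n < p)%N then 0 else hasse_term x m (n - p)).
Proof.
move=> pR; rewrite -!coef_hasse_term exprD exprD_pchar; last first.
  by rewrite pchar_poly.
by rewrite mulrDl coefD coefXnM -polyC_exp coefCM addrC.
Qed.

(* Lucas' congruence, read off from ((X + x)^a)^p = (X^p + x^p)^a. *)
Lemma hasse_term_Lucas (R : comNzRingType) (p : nat) (x : R) a a' c c' :
  p \in [pchar R] -> (c < p)%N -> (c' < p)%N ->
  hasse_term x (a * p + c) (a' * p + c') =
    hasse_term x a a' ^+ p * hasse_term x c c'.
Proof.
move=> pR lt_cp lt_c'p; have p_gt0 := prime_gt0 (pcharf_prime pR).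
elim: a a' => [|a IHa] [|a'].
- by rewrite hasse_term0 expr1n mul1r.
- rewrite hasse_term_small; last first.
    by rewrite mulSn -addnA (leq_trans lt_cp) ?leq_addr.
  by rewrite hasse_term_small // expr0n gtn_eqF // mul0r.
- rewrite mulSn -addnA hasse_term_addp // lt_c'p addr0 IHa !hasse_term0.
  by rewrite mulrA -exprMn -exprS.
- rewrite mulSn -addnA hasse_term_addp // IHa ltnNge mulSn -addnA leq_addr /=.
  rewrite addKn IHa hasse_termSS exprD_pchar // [(x * _) ^+ p]exprMn.
  by rewrite mulrDl mulrA addrC.
Qed.

(** * Hasse derivatives of monomials in several variables *)

Definition hasse_monomial (A : comNzRingType) (B : set A)
    (alpha beta : multi_index B) : A :=
  (mi_binomial alpha beta)%:R * monomial (mi_sub alpha beta).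

Lemma mi_subE (I : choiceType) (alpha beta : multi_index I) b :
  mi_sub alpha beta b = (alpha b - beta b)%N.
Proof. by rewrite fsfunE; case: finsuppP => // _; rewrite sub0n. Qed.

Lemma monomial_fset (A : comNzRingType) (B : set A) (alpha : multi_index B)
    (F : {fset B}) :
  (finsupp alpha `<=` F)%fset -> monomial alpha = \prod_(b <- F) val b ^+ alpha b.
Proof.
move=> sF; apply: big_fset_incl => // b _ bF.
by rewrite fsfun_dflt.
Qed.

(** Variables outside both supports contribute the factor 1. One finite set can therefore serve
    several multi-indices at once, which reduces identities to one variable. *)
Lemma hasse_monomial_fset (A : comNzRingType) (B : set A)
    (alpha beta : multi_index B) (F : {fset B}) :
  (finsupp alpha `<=` F)%fset -> (finsupp beta `<=` F)%fset ->
  hasse_monomial alpha beta =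
    \prod_(b <- F) hasse_term (val b) (alpha b) (beta b).
Proof.
move=> sa sb; rewrite big_split /= -natr_prod; congr (_ %:R * _).
  apply: big_fset_incl; first by rewrite fsubUset sa.
  by move=> b _; rewrite in_fsetU negb_or => /andP[/fsfun_dflt-> /fsfun_dflt->].
rewrite (@monomial_fset _ _ _ F).
  by apply: eq_bigr => b _; rewrite mi_subE.
apply: fsubset_trans sa; apply/fsubsetP => b; rewrite !mem_finsupp mi_subE.
by apply: contra => /eqP->.
Qed.

(** * Coordinates with respect to a p-basis *)

Lemma reduced_expr_pchar_inj (A : comNzRingType) (p : nat) :
  p \in [pchar A] -> reduced_ring A -> injective (fun x : A => x ^+ p).
Proof.
move=> pA A_reduced x y /= exy; apply/eqP; rewrite -subr_eq0; apply/eqP.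
apply: (A_reduced _ p); apply: (addIr (y ^+ p)).
by rewrite -exprD_pchar // subrK add0r.
Qed.

(** The difference of the two sides is a relation with coefficients [(u i - w i) ^+ p] in A^p;
    independence kills these, and reducedness removes the power. *)
Lemma absolute_p_basis_uniq (A : comNzRingType) (p : nat) (B : set A)
    (F : {fset p_exponents p B}) (u w : p_exponents p B -> A) :
  p \in [pchar A] -> reduced_ring A -> absolute_p_basis p B ->
  \sum_(i <- F) u i ^+ p * monomial (val i) =
    \sum_(i <- F) w i ^+ p * monomial (val i) ->
  {in F, u =1 w}.
Proof.
move=> pA A_reduced [_ indep] /eqP; rewrite -subr_eq0 -sumrB => /eqP eq_uw i Fi.
have p_gt0 := prime_gt0 (pcharf_prime pA).
pose c := [fsfun i in F => (u i - w i) ^+ p | 0 : A].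
have cE j : j \in F -> c j = (u j - w j) ^+ p by rewrite fsfunE => ->.
suff /(_ i) : forall j, c j = 0.
  by rewrite cE // => /A_reduced/eqP; rewrite subr_eq0 => /eqP.
apply: indep => [j|].
  rewrite fsfunE; case: ifP => _; first by exists (u j - w j).
  by exists 0; rewrite ?expr0n ?gtn_eqF.
rewrite -[RHS]eq_uw (@big_fset_incl _ _ _ _ _ F).
- apply: eq_big_seq => j Fj; rewrite cE // -mulrBl; congr (_ * _).
  by apply: (addIr (w j ^+ p)); rewrite -exprD_pchar // !subrK.
- by apply/fsubsetP => j; rewrite mem_finsupp fsfunE; case: ifP => //; rewrite eqxx.
- by move=> j _ /fsfun_dflt->; rewrite mul0r.
Qed.

(** The p-th roots of the coordinates of an element are unique and depend additively on it, so
    additive maps may be prescribed separately on each summand A^p B^gamma. *)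
Lemma absolute_p_basis_ext (A : comNzRingType) (p : nat) (B : set A)
    (g : multi_index B -> A -> A) :
  p \in [pchar A] -> reduced_ring A -> absolute_p_basis p B ->
  (forall gamma, {morph g gamma : x y / x + y}) ->
  exists D : A -> A, {morph D : x y / x + y} /\
    forall gamma c, p_exponents p B gamma ->
      D (c ^+ p * monomial gamma) = g gamma c.
Proof.
move=> pA A_reduced Bp gD; have p_gt0 := prime_gt0 (pcharf_prime pA).
have g0 gamma : g gamma 0 = 0.
  by apply: (addrI (g gamma 0)); rewrite -gD !addr0.
have inj_p := reduced_expr_pchar_inj pA A_reduced.
have [c cP] := choice Bp.1.
have /choice[k kP] x : exists u : p_exponents p B -> A, forall i, u i ^+ p = c x i.
  have /choice[u uP] i : exists y, y ^+ p = c x i.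
    by have [y _ <-] := (cP x).1 i; exists y.
  by exists u.
(* Injectivity of Frobenius makes the chosen root of a zero coordinate zero, so [D] can be computed
   over any finite set containing the support. *)
have k_dflt x i : i \notin finsupp (c x) -> k x i = 0.
  by move/fsfun_dflt => cxi0; apply: inj_p; rewrite kP cxi0 expr0n gtn_eqF.
have kE x (F : {fset p_exponents p B}) : (finsupp (c x) `<=` F)%fset ->
    \sum_(i <- F) k x i ^+ p * monomial (val i) = x.
  move=> sF; rewrite [RHS](cP x).2 [RHS](@big_fset_incl _ _ _ _ _ F) //.
    by apply: eq_bigr => i _; rewrite kP.
  by move=> i _ /fsfun_dflt->; rewrite mul0r.
pose D x := \sum_(i <- finsupp (c x)) g (val i) (k x i).
have DE x (F : {fset p_exponents p B}) : (finsupp (c x) `<=` F)%fset ->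
    D x = \sum_(i <- F) g (val i) (k x i).
  by move=> sF; apply: big_fset_incl => // i _ /k_dflt->.
exists D; split=> [x y | gamma a gamma_lt].
  pose F := (finsupp (c x) `|` finsupp (c y) `|` finsupp (c (x + y)%R))%fset.
  have sx : (finsupp (c x) `<=` F)%fset by rewrite /F -fsetUA fsubsetUl.
  have sy : (finsupp (c y) `<=` F)%fset by rewrite /F fsetUAC fsubsetUr.
  have sxy : (finsupp (c (x + y)%R) `<=` F)%fset by rewrite /F fsubsetUr.
  rewrite (DE _ F sx) (DE _ F sy) (DE _ F sxy) -big_split /=.
  apply: eq_big_seq => i Fi; rewrite -gD; congr (g _ _).
  (* Both [k (x + y)] and [k x + k y] are families of roots of coordinates of [x + y]. *)
  move: i Fi; apply: (absolute_p_basis_uniq (w := fun i => k x i + k y i)) => //.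
  rewrite kE // -{1}(kE x F sx) -{1}(kE y F sy) -big_split; apply: eq_bigr => i _.
  by rewrite /= exprD_pchar // mulrDl.
pose i0 : p_exponents p B := exist _ gamma (mem_set gamma_lt).
have [x xE] : exists x, x = a ^+ p * monomial gamma.
  by exists (a ^+ p * monomial gamma).
rewrite -xE; pose F := (i0 |` finsupp (c x))%fset.
have sx : (finsupp (c x) `<=` F)%fset by rewrite fsubsetUr.
have Fi0 : i0 \in F by rewrite fset1U1.
(* The obvious one-term expansion of [x]; by uniqueness it agrees with the chosen one. *)
pose w i := if i == i0 then a else 0.
have kw : {in F, k x =1 w}.
  apply: absolute_p_basis_uniq => //.
  rewrite (kE x F sx).
  rewrite (big_fsetD1 i0 Fi0).
  rewrite /= {1}/w eqxx.
  rewrite -xE.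
  rewrite big1_seq; first by rewrite addr0.
  move=> i /andP[_]; rewrite in_fsetD1 /w => /andP[/negPf-> _].
  by rewrite expr0n gtn_eqF // mul0r.
rewrite (DE _ F sx) (big_fsetD1 i0 Fi0) /= kw // {1}/w eqxx.
rewrite big1_seq; first by rewrite addr0.
move=> i /andP[_]; rewrite in_fsetD1 => /andP[/negPf ii0 Fi].
by rewrite kw // /w ii0 g0.
Qed.

Lemma absolute_p_basis_ind (A : comNzRingType) (p : nat) (B : set A)
    (P : A -> Prop) :
  prime p -> absolute_p_basis p B -> (forall x y, P x -> P y -> P (x + y)) ->
  (forall c gamma, p_exponents p B gamma -> P (c ^+ p * monomial gamma)) ->
  forall x, P x.
Proof.
move=> p_prime [gen _] PD Pm x; have [c [Sc ->]] := gen x.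
elim/big_ind: _ => // [|i _]; last first.
  by have [y _ <-] := Sc i; apply: Pm; apply: set_mem (valP i).
(* The empty sum is covered by the hypothesis on [c ^+ p * monomial gamma] at [c = 0]. *)
have <- : 0 ^+ p * monomial (B := B) [fsfun] = 0 :> A.
  by rewrite expr0n gtn_eqF ?prime_gt0 // mul0r.
by apply: Pm => b; rewrite fsfunE prime_gt0.
Qed.

(** * Arithmetic of multi-indices, and Lucas' congruence for monomials *)

Lemma mi_exists (I : choiceType) (F : {fset I}) (f : I -> nat) :
  (forall b, b \notin F -> f b = 0%N) ->
  exists alpha : multi_index I, forall b, alpha b = f b.
Proof.
move=> f_dflt; exists [fsfun b in F => f b | 0%N] => b.
by rewrite fsfunE; case: ifPn => // /f_dflt.
Qed.

Lemma mi_combination (I : choiceType) (n : nat) (alpha gamma : multi_index I) :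
  exists delta : multi_index I, forall b, delta b = (alpha b * n + gamma b)%N.
Proof.
apply: (mi_exists (F := finsupp alpha `|` finsupp gamma)%fset) => b.
by rewrite in_fsetU negb_or => /andP[/fsfun_dflt-> /fsfun_dflt->].
Qed.

Lemma mi_euclid (I : choiceType) (n : nat) (alpha : multi_index I) :
  (0 < n)%N -> exists q r : multi_index I,
    [/\ forall b, q b = (alpha b %/ n)%N, forall b, alpha b = (q b * n + r b)%N
      & forall b, (r b < n)%N].
Proof.
move=> n_gt0.
have [b|q qE] := mi_exists (F := finsupp alpha) (f := fun b => alpha b %/ n)%N.
  by move/fsfun_dflt->; rewrite div0n.
have [b|r rE] := mi_exists (F := finsupp alpha) (f := fun b => alpha b %% n)%N.
  by move/fsfun_dflt->; rewrite mod0n.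
by exists q, r; split=> // b; rewrite ?qE rE -?divn_eq ?ltn_pmod.
Qed.

Lemma mi_unit (I : choiceType) (b0 : I) :
  exists u : multi_index I, forall b, u b = (b == b0)%N.
Proof.
by apply: (mi_exists (F := [fset b0]%fset)) => b; rewrite in_fset1 => /negPf->.
Qed.

Lemma monomial_combination (A : comNzRingType) (B : set A) (n : nat)
    (alpha gamma delta : multi_index B) :
  (forall b, delta b = (alpha b * n + gamma b)%N) ->
  monomial delta = monomial alpha ^+ n * monomial gamma.
Proof.
move=> deltaE; pose F := (finsupp alpha `|` finsupp gamma `|` finsupp delta)%fset.
rewrite !(@monomial_fset _ _ _ F) ?fsubsetUr //; first last.
- by rewrite /F -fsetUA fsubsetUl.
- by rewrite /F fsetUAC fsubsetUr.
rewrite -prodrXl -big_split; apply: eq_bigr => b _.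
by rewrite /= deltaE exprD exprM.
Qed.

Lemma monomial0 (A : comNzRingType) (B : set A) (alpha : multi_index B) :
  (forall b, alpha b = 0%N) -> monomial alpha = 1.
Proof. by move=> alpha0; rewrite /monomial big1 // => b _; rewrite alpha0. Qed.

Lemma monomial_unit (A : comNzRingType) (B : set A) (b0 : B) (u : multi_index B) :
  (forall b, u b = (b == b0)%N) -> monomial u = val b0.
Proof.
move=> uE; rewrite (@monomial_fset _ _ _ [fset b0]%fset).
  by rewrite big_seq_fset1 uE eqxx.
apply/fsubsetP => b; rewrite mem_finsupp uE in_fset1.
by case: (b == b0).
Qed.

Lemma hasse_monomial0 (A : comNzRingType) (B : set A) (alpha beta : multi_index B) :
  (forall b, beta b = 0%N) -> hasse_monomial alpha beta = monomial alpha.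
Proof.
move=> beta0; pose F := (finsupp alpha `|` finsupp beta)%fset.
rewrite (@hasse_monomial_fset _ _ _ _ F) ?fsubsetUl ?fsubsetUr //.
rewrite (@monomial_fset _ _ _ F) ?fsubsetUl //.
by apply: eq_bigr => b _; rewrite beta0 hasse_term0.
Qed.

Lemma hasse_monomial_Lucas (A : comNzRingType) (p : nat) (B : set A)
    (alpha q r beta q' r' : multi_index B) :
  p \in [pchar A] ->
  (forall b, alpha b = (q b * p + r b)%N) -> (forall b, (r b < p)%N) ->
  (forall b, beta b = (q' b * p + r' b)%N) -> (forall b, (r' b < p)%N) ->
  hasse_monomial alpha beta = hasse_monomial q q' ^+ p * hasse_monomial r r'.
Proof.
move=> pA alphaE r_lt betaE r'_lt.
have p_gt0 := prime_gt0 (pcharf_prime pA).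
pose F := (finsupp alpha `|` finsupp beta)%fset.
(* Quotient and remainder by [p] are bounded by the original exponent, so their supports stay inside
   [F]. *)
have sub_alpha (delta : multi_index B) : (forall b, (delta b <= alpha b)%N) ->
    (finsupp delta `<=` F)%fset.
  move=> le_da; apply/fsubsetP => b; rewrite in_fsetU !mem_finsupp -!lt0n.
  by move=> /leq_trans->.
have sub_beta (delta : multi_index B) : (forall b, (delta b <= beta b)%N) ->
    (finsupp delta `<=` F)%fset.
  move=> le_db; apply/fsubsetP => b; rewrite in_fsetU !mem_finsupp -!lt0n orbC.
  by move=> /leq_trans->.
have le_quo m n : (m <= m * p + n)%N by rewrite (leq_trans _ (leq_addr _ _)) ?leq_pmulr.
rewrite (hasse_monomial_fset (sub_alpha alpha _) (sub_beta beta _)) //.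
rewrite (hasse_monomial_fset (sub_alpha q _) (sub_beta q' _)); last 2 first.
- by move=> b; rewrite alphaE.
- by move=> b; rewrite betaE.
rewrite (hasse_monomial_fset (sub_alpha r _) (sub_beta r' _)); last 2 first.
- by move=> b; rewrite alphaE leq_addl.
- by move=> b; rewrite betaE leq_addl.
rewrite -prodrXl -big_split; apply: eq_bigr => b _ /=.
by rewrite alphaE betaE hasse_term_Lucas.
Qed.

(** Expanding the coefficients again, [e] times in all, shows that monomials span A over its p^e-th
    powers. *)
Lemma absolute_p_basis_ind_pow (A : comNzRingType) (p e : nat) (B : set A)
    (P : A -> Prop) :
  p \in [pchar A] -> absolute_p_basis p B ->
  (forall x y, P x -> P y -> P (x + y)) ->
  (forall c x, P x -> P (c ^+ (p ^ e) * x)) ->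
  (forall alpha, P (monomial (B := B) alpha)) -> forall x, P x.
Proof.
move=> pA Bp; elim: e P => [|e IHe] P PD PX Pm x.
  (* For [e = 0] every element is itself a first power, times the empty monomial. *)
  rewrite -[x]expr1 -[_ ^+ 1]mulr1 -(monomial0 (B := B) (alpha := [fsfun])).
    exact: PX.
  by move=> b; rewrite fsfunE.
apply: (absolute_p_basis_ind (pcharf_prime pA) Bp PD) => {x} c gamma _.
(* The induction hypothesis is applied to the coefficient [c], with [gamma] fixed. *)
apply: (IHe (fun c => P (c ^+ p * monomial gamma))) => [{}c d Pc Pd|{}c d Pd|alpha].
- by rewrite exprD_pchar // mulrDl; apply: PD.
- by rewrite exprMn -exprM -expnSr -mulrA; apply: PX.
- have [delta deltaE] := mi_combination p alpha gamma.
  by rewrite -(monomial_combination deltaE).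
Qed.

(** * Construction of the operators *)

(* Linearity over q-th powers, q = p^e, makes D determined by its values on
   monomials, since those span A over A^q. *)
Definition is_hasse (A : comNzRingType) (B : set A) (q : nat)
    (beta : multi_index B) (D : A -> A) : Prop :=
  [/\ {morph D : x y / x + y}, forall c x, D (c ^+ q * x) = c ^+ q * D x
    & forall alpha, D (monomial alpha) = hasse_monomial alpha beta].

Lemma is_hasse_exists (A : comNzRingType) (p e : nat) (B : set A)
    (beta : multi_index B) :
  p \in [pchar A] -> reduced_ring A -> absolute_p_basis p B ->
  (forall b, (beta b < p ^ e)%N) -> exists D, is_hasse (p ^ e) beta D.
Proof.
move=> pA A_reduced Bp; have p_gt0 := prime_gt0 (pcharf_prime pA).
elim: e beta => [|e IHe] beta beta_lt.
  (* The bound [p ^ 0 = 1] forces [beta = 0]. *)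
  exists id; split=> // alpha; rewrite hasse_monomial0 // => b.
  by apply/eqP; rewrite -leqn0 -ltnS.
have [q [r [qE betaE r_lt]]] := mi_euclid beta p_gt0.
have [b|D1 [D1D D1X D1m]] := IHe q; first by rewrite qE ltn_divLR // -expnSr.
pose g gamma c := D1 c ^+ p * hasse_monomial gamma r.
have [|D [DD Dg]] := absolute_p_basis_ext (g := g) pA A_reduced Bp.
  by move=> gamma x y; rewrite /g D1D exprD_pchar // mulrDl.
exists D; split=> // [c|alpha].
  apply: (absolute_p_basis_ind (pcharf_prime pA) Bp) => [x y Dx Dy|d gamma gamma_lt].
    by rewrite mulrDr !DD Dx Dy mulrDr.
  (* On a generator, c^(p^(e+1)) d^p = (c^(p^e) d)^p, so the linearity of [D1] over p^e-th powers
     applies. *)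
  rewrite expnSr exprM mulrA -exprMn !Dg // /g D1X exprMn.
  by rewrite mulrA.
have [a [s [_ alphaE s_lt]]] := mi_euclid alpha p_gt0.
rewrite (monomial_combination alphaE) Dg // /g D1m.
by rewrite -(hasse_monomial_Lucas pA alphaE s_lt betaE r_lt).
Qed.

(** * Pascal's rule for monomials, and degrees *)

Lemma hasse_monomialS0 (A : comNzRingType) (B : set A) (b0 : B)
    (alpha alpha' beta : multi_index B) :
  (forall b, alpha' b = ((b == b0) + alpha b)%N) -> beta b0 = 0%N ->
  hasse_monomial alpha' beta = val b0 * hasse_monomial alpha beta.
Proof.
move=> alpha'E betab0.
pose F := (b0 |` finsupp alpha `|` finsupp alpha' `|` finsupp beta)%fset.
have Fb0 : b0 \in F by rewrite !inE eqxx.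
have sa : (finsupp alpha `<=` F)%fset.
  by apply/fsubsetP => b b_in; rewrite !in_fsetU b_in !orbT.
have sa' : (finsupp alpha' `<=` F)%fset.
  by apply/fsubsetP => b b_in; rewrite !in_fsetU b_in !orbT.
rewrite !(@hasse_monomial_fset _ _ _ _ F) ?fsubsetUr // !(big_fsetD1 b0 Fb0) /=.
rewrite alpha'E betab0 eqxx !hasse_term0 exprS -mulrA; congr (_ * (_ * _)).
apply: eq_big_seq => b; rewrite in_fsetD1 => /andP[/negPf bb0 _].
by rewrite alpha'E bb0.
Qed.

(** Only the factor at [b0] changes, and there it is the one-variable Pascal rule. This computes the
    commutator of [val b0] with the operator of index [beta']. *)
Lemma hasse_monomialSS (A : comNzRingType) (B : set A) (b0 : B)
    (alpha alpha' beta beta' : multi_index B) :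
  (forall b, alpha' b = ((b == b0) + alpha b)%N) ->
  (forall b, beta' b = ((b == b0) + beta b)%N) ->
  hasse_monomial alpha' beta' =
    hasse_monomial alpha beta + val b0 * hasse_monomial alpha beta'.
Proof.
move=> alpha'E beta'E.
pose F := (b0 |` finsupp alpha `|` finsupp alpha' `|` finsupp beta
  `|` finsupp beta')%fset.
have Fb0 : b0 \in F by rewrite !inE eqxx.
have sa : (finsupp alpha `<=` F)%fset.
  by apply/fsubsetP => b b_in; rewrite !in_fsetU b_in !orbT.
have sa' : (finsupp alpha' `<=` F)%fset.
  by apply/fsubsetP => b b_in; rewrite !in_fsetU b_in !orbT.
have sb : (finsupp beta `<=` F)%fset.
  by apply/fsubsetP => b b_in; rewrite !in_fsetU b_in !orbT.
rewrite !(@hasse_monomial_fset _ _ _ _ F) ?fsubsetUr // !(big_fsetD1 b0 Fb0) /=.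
pose h b := hasse_term (val b) (alpha b) (beta b).
rewrite (eq_big_seq h) => [|b]; last first.
  by rewrite in_fsetD1 /h alpha'E beta'E => /andP[/negPf-> _].
rewrite [X in _ + val b0 * (_ * X)](eq_big_seq h) => [|b]; last first.
  by rewrite in_fsetD1 /h beta'E => /andP[/negPf-> _].
by rewrite alpha'E beta'E eqxx hasse_termSS mulrA -mulrDl.
Qed.

Lemma mi_degS (I : choiceType) (b0 : I) (beta beta' : multi_index I) :
  (forall b, beta' b = ((b == b0) + beta b)%N) -> mi_deg beta' = (mi_deg beta).+1.
Proof.
move=> beta'E; pose F := (b0 |` finsupp beta `|` finsupp beta')%fset.
have Fb0 : b0 \in F by rewrite !inE eqxx.
have degE (gamma : multi_index I) : (finsupp gamma `<=` F)%fset ->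
    mi_deg gamma = (\sum_(b <- F) gamma b)%N.
  by move=> sF; apply: big_fset_incl => // b _ /fsfun_dflt->.
rewrite !degE ?fsubsetUr //; last by rewrite /F fsetUAC fsubsetUr.
rewrite !(big_fsetD1 b0 Fb0) /= beta'E eqxx add1n addSn; congr (_ + _).+1.
by apply: eq_big_seq => b; rewrite in_fsetD1 beta'E => /andP[/negPf-> _].
Qed.

Lemma mi_pred (I : choiceType) (b0 : I) (beta : multi_index I) :
  (0 < beta b0)%N ->
  exists gamma : multi_index I, forall b, beta b = ((b == b0) + gamma b)%N.
Proof.
move=> beta_gt0.
have [b|gamma gammaE] := mi_exists (F := finsupp beta)
  (f := fun b => (beta b - (b == b0))%N).
  by move/fsfun_dflt->.
exists gamma => b; rewrite gammaE; case: eqP => [->|_]; last by rewrite subn0.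
by rewrite subnKC.
Qed.

(** * Closure properties of differential operators *)

Lemma diff_op0 (k : comNzRingType) (A : comAlgType k) (M : lmodType A) n :
  diff_op k n (fun _ : A => 0 : M).
Proof.
elim: n => [|n IHn] /=; first by move=> a x y; rewrite scaler0 addr0.
split=> [c x y|a]; first by rewrite scaler0 addr0.
by rewrite (_ : commutator _ _ = fun=> 0) //; apply/funext => x;
  rewrite /commutator scaler0 subr0.
Qed.

Lemma diff_opD (k : comNzRingType) (A : comAlgType k) (M : lmodType A) n
    (D E : A -> M) :
  diff_op k n D -> diff_op k n E -> diff_op k n (fun x => D x + E x).
Proof.
elim: n D E => [|n IHn] D E /=.
  by move=> linD linE a x y; rewrite linD linE scalerDr addrACA.
move=> [linD DD] [linE EE]; split=> [c x y|a].
  by rewrite linD linE scalerDr addrACA.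
rewrite (_ : commutator _ _ = fun x => commutator a D x + commutator a E x).
  exact: IHn.
by apply/funext => x; rewrite /commutator scalerDr opprD addrACA.
Qed.

Lemma diff_opZ (k : comNzRingType) (A : comAlgType k) (M : lmodType A) n
    (c : A) (D : A -> M) :
  diff_op k n D -> diff_op k n (fun x => c *: D x).
Proof.
elim: n D => [|n IHn] D /=.
  by move=> linD a x y; rewrite linD scalerDr !scalerA mulrC.
move=> [linD DD]; split=> [d x y|a].
  by rewrite linD scalerDr !scalerA mulrC.
rewrite (_ : commutator _ _ = fun x => c *: commutator a D x); first exact: IHn.
by apply/funext => x; rewrite /commutator scalerBr !scalerA mulrC.
Qed.

(** Multiplications by [a] and by [c] commute, so taking the commutator with [a] commutes with
    precomposition by [c]. *)
Lemma diff_op_mull (k : comNzRingType) (A : comAlgType k) (M : lmodType A) n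
    (c : A) (D : A -> M) :
  diff_op k n D -> diff_op k n (fun x => D (c * x)).
Proof.
elim: n D => [|n IHn] D /=.
  move=> linD a x y; rewrite -linD; congr D.
  by rewrite mulrDr; congr (_ + _); apply: mulrCA.
move=> [linD DD]; split=> [d x y|a].
  by rewrite -linD mulrDr scalerAr.
rewrite (_ : commutator _ _ = fun x => commutator a D (c * x)); first exact: IHn.
by apply/funext => x; rewrite /commutator mulrCA.
Qed.

(** * The order of the operators *)

Lemma is_hasse_diff_op (p e : nat) (A : comAlgType 'F_p) (B : set A)
    (beta : multi_index B) (D : A -> A) :
  p \in [pchar A] -> absolute_p_basis p B -> is_hasse (p ^ e) beta D ->
  diff_op 'F_p (mi_deg beta) (D : A -> A^o).
Proof.
move=> pA Bp; have p_gt0 := prime_gt0 (pcharf_prime pA).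
have Bind := absolute_p_basis_ind_pow (e := e) pA Bp.
(* [D] is generalised along with [beta]: the induction hypothesis is needed for a commutator, known
   only through [is_hasse] with the same [e]. *)
move deg_beta: (mi_deg beta) => n; elim: n => [|n IHn] in beta deg_beta D *.
  move=> [DD DX Dm].
  have beta0 b : beta b = 0%N.
    apply/eqP; rewrite -leqn0 leqNgt; apply/negP => /mi_pred[gamma /mi_degS].
    by rewrite deg_beta.
  (* [D] agrees with the identity on monomials, and both are linear over p^e-th powers. *)
  suff DE x : D x = x by move=> c x y; rewrite !DE.
  move: x; apply: Bind => [x y Dx Dy|c x Dx|alpha].
  - by rewrite DD Dx Dy.
  - by rewrite DX Dx.
  - by rewrite Dm hasse_monomial0.
move=> [DD DX Dm].
have D0 : D 0 = 0 by apply: (addrI (D 0)); rewrite -DD !addr0.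
(* Scalars in ['F_p] are classes of natural numbers, so additivity yields linearity over the
   base. *)
have Dn x m : D (x *+ m) = D x *+ m.
  by elim: m => [|m IHm]; rewrite ?mulr0n // !mulrS DD IHm.
split=> [c x y|].
  rewrite DD; congr (_ + _); apply: etrans (esym (mulr_algl c (D x))).
  by rewrite -[c]natr_Zp !scaler_nat Dn.
pose P a := diff_op 'F_p n (commutator (a : A) (D : A -> A^o)).
have PD a a' : P a -> P a' -> P (a + a').
  move=> Pa Pa'; rewrite /P (_ : commutator _ _ = fun x =>
    commutator (a : A) (D : A -> A^o) x + commutator (a' : A) (D : A -> A^o) x).
    exact: diff_opD.
  apply/funext => x; rewrite /commutator scalerDl mulrDl DD opprD.
  exact: addrACA.
have P1 : P 1.
  rewrite /P (_ : commutator _ _ = fun=> 0); first exact: diff_op0.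
  by apply/funext => x; rewrite /commutator scale1r mul1r subrr.
have PM a a' : P a -> P a' -> P (a * a').
  (* Leibniz rule: [a a', D] = a [a', D] + [a, D] composed with multiplication by a'. *)
  move=> Pa Pa'; rewrite /P (_ : commutator _ _ = fun x =>
    (a : A) *: commutator (a' : A) (D : A -> A^o) x
      + commutator (a : A) (D : A -> A^o) (a' * x)).
    by apply: diff_opD; [apply: diff_opZ | apply: diff_op_mull].
  apply/funext => x; rewrite /commutator scalerBr scalerA mulrA.
  by rewrite addrA subrK.
have Pgen (b : B) : P (val b).
  have [u uE] := mi_unit b.
  have mulb (alpha : multi_index B) : exists alpha' : multi_index B,
      (forall b', alpha' b' = ((b' == b) + alpha b')%N) /\
      val b * monomial alpha = monomial alpha'.
    have [alpha' alpha'E] := mi_combination 1 u alpha.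
    exists alpha'; split=> [b'|]; first by rewrite alpha'E uE muln1.
    by rewrite (monomial_combination alpha'E) expr1 (monomial_unit uE).
  have [beta_b0|/mi_pred[gamma betaE]] := posnP (beta b).
    (* If [beta b = 0], then [D] commutes with multiplication by [val b], as is checked on
       monomials. *)
    rewrite /P (_ : commutator _ _ = fun=> 0); first exact: diff_op0.
    apply/funext => x; apply/eqP; rewrite subr_eq0; apply/eqP.
    rewrite -[LHS]/(val b * D x).
    move: x; apply: Bind => [x y Dx Dy|c x Dx|alpha].
    - by rewrite mulrDr !DD mulrDr Dx Dy.
    - by rewrite DX mulrCA Dx mulrCA DX.
    - have [alpha' [alpha'E ->]] := mulb alpha.
      by rewrite !Dm (hasse_monomialS0 alpha'E).
  have deg_gamma : mi_deg gamma = n.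
    by apply: succn_inj; rewrite -deg_beta (mi_degS betaE).
  (* [E] is minus the commutator, the sign for which Pascal's rule gives exactly the operator of
     index [gamma]. *)
  pose E x := D (val b * x) - val b * D x.
  have : is_hasse (p ^ e) gamma E.
    split=> [x y|c x|alpha].
    - by rewrite /E mulrDr !DD mulrDr opprD addrACA.
    - by rewrite /E mulrCA !DX mulrCA mulrBr.
    - have [alpha' [alpha'E mulE]] := mulb alpha.
      by rewrite /E mulE !Dm (hasse_monomialSS alpha'E betaE) addrK.
  move=> /(IHn _ deg_gamma)/(diff_opZ (-1)).
  rewrite /P; congr diff_op; apply/funext => x.
  by rewrite /commutator scaleN1r opprB.
apply: (absolute_p_basis_ind_pow (e := e) pA Bp) => // [c x Px|alpha].
  (* Since [D] commutes with multiplication by p^e-th powers, such a factor comes out of the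
     commutator. *)
  rewrite -/(P _) /P (_ : commutator _ _ = fun y =>
    (c ^+ (p ^ e) : A) *: commutator (x : A) (D : A -> A^o) y).
    exact: diff_opZ.
  by apply/funext => y; rewrite /commutator scalerBr scalerA -mulrA DX.
rewrite -/(P _) /monomial; elim/big_ind: _ => // b _.
by elim: (alpha b) => // m IHm; rewrite exprS; apply: PM.
Qed.

Theorem proposition6p3 (p : nat) (p_prime : prime p) (A : comAlgType 'F_p)
    (A_reduced : reduced_ring A) (B : set A) (B_basis : absolute_p_basis p B)
    (beta : multi_index B) :
  exists D : A -> A,
    diff_op 'F_p (mi_deg beta) (D : A -> A^o) /\
    forall alpha : multi_index B,
      D (monomial alpha) =
      (mi_binomial alpha beta)%:R * monomial (mi_sub alpha beta).
Proof.
have pA : p \in [pchar A].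
  rewrite inE p_prime /= -scaler_nat.
  by rewrite (pcharf0 (pchar_Fp p_prime)) scale0r.
(* The choice [e = mi_deg beta] works because beta_b <= |beta| < p^|beta|. *)
have beta_lt b : (beta b < p ^ mi_deg beta)%N.
  apply: leq_ltn_trans (ltn_expl _ (prime_gt1 p_prime)).
  case: finsuppP => // b_in; rewrite /mi_deg (big_fsetD1 b) //=.
  exact: leq_addr.
have [D hD] := is_hasse_exists pA A_reduced B_basis beta_lt.
by exists D; split; [apply: is_hasse_diff_op hD | case: hD].
Qed.
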